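(* Let $n\ge 1$, $\zeta_n:=e^{2\pi i/n}$, $F:=\mathbb{Q}(\zeta_n)\subset\mathbb{C}$ and $E:=F\cap\mathbb{R}$. Let $d=2k+1$ be odd, with $k\geq 0$ an integer, and let $P\in\operatorname{GL}_d(F)$ and $\mu\in E$ satisfy $P\overline{P}=\mu I$. Then $x:=\mu^{-k}\det P\in F$ is a solution of the norm equation $x\overline{x}=\mu$.
   Context: The bar denotes complex conjugation, applied entrywise to matrices; $F$ is stable under it. $I$ is the $d\times d$ identity matrix. *)

(* Defs.v *)
From HB Require Import structures.
From mathcomp Require Import all_boot all_order all_algebra.
From mathcomp Require Import all_classical all_reals all_analysis.
From mathcomp Require Export complex.

Set Implicit Arguments.
Unset Strict Implicit.
Unset Printing Implicit Defensive.

Import Order.TTheory GRing.Theory Num.Theory.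
Local Open Scope ring_scope.
Local Open Scope complex_scope.

(* exp (a + b i) = exp a * (cos b + i sin b) *)
Definition expC (R : realType) (z : R[i]) : R[i] :=
  (expR (complex.Re z))%:C * (cos (complex.Im z) +i* sin (complex.Im z)).

Definition zeta (R : realType) (n : nat) : R[i] :=
  expC (2%:R * (pi : R)%:C%C * 'i%C / n%:R).

(* Q(zeta_n), the smallest subfield of the complex numbers containing zeta_n.
   Since 0^-1 = 0, [divring_closed] is closure under the field operations. *)
Definition cyclo_field (R : realType) (n : nat) : {pred R[i]} :=
  fun z => `[< forall S : {pred R[i]},
                 divring_closed S -> zeta R n \in S -> z \in S >].

Fact cyclo_field_divring_closed (R : realType) (n : nat) :
  divring_closed (@cyclo_field R n).
Proof.
split=> [|x y /asboolP Fx /asboolP Fy|x y /asboolP Fx /asboolP Fy];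
  apply/asboolP => S SS Sz.
- by case: SS.
- by case: (SS) => _ SB _; apply: SB; [exact: Fx|exact: Fy].
- by case: (SS) => _ _ SD; apply: SD; [exact: Fx|exact: Fy].
Qed.

HB.instance Definition _ (R : realType) (n : nat) :=
  GRing.isDivringClosed.Build R[i] (@cyclo_field R n)
    (@cyclo_field_divring_closed R n).

Definition cyclo_real (R : realType) (n : nat) : {pred R[i]} :=
  [predI @cyclo_field R n & Num.real].

(* GL_d(K) for a subfield K of C: the inverse is also required to have its
   entries in K. *)
Definition in_GL (C : fieldType) (K : {pred C}) (d : nat) (P : 'M[C]_d) :=
  [/\ P \is a mxOver K, P \in unitmx & invmx P \is a mxOver K].

(* Main.v *)
Require Import Defs.
From mathcomp Require Import all_boot all_order all_algebra.
From mathcomp Require Import all_classical all_reals all_analysis.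

Import GRing.Theory Num.Theory.
Local Open Scope ring_scope.

(** Taking determinants in [P *m conj P = mu I] gives
    [det P * conj (det P) = mu ^ d] ([det_norm_scalar]), so [mu ^ d] is
    already a norm. As [d = 2 k + 1], it is [mu] times [mu ^ (2 k)], which is
    the norm of [mu ^ k] because [mu] is real; dividing [det P] by [mu ^ k]
    therefore leaves an element of norm [mu] ([norm_div_expr]). The division
    is legitimate because [det P], hence its norm [mu ^ d], is nonzero, and
    the quotient stays in [F] because a determinant is a polynomial with
    integer coefficients in the entries ([det_mxOver]). *)

Lemma det_mxOver (A : comNzRingType) (S : subringClosed A) (d : nat)
    (M : 'M[A]_d) :
  M \is a mxOver S -> \det M \in S.
Proof.
move=> /mxOverP SM; apply: rpred_sum => s _.
by rewrite rpredMsign; apply: rpred_prod => i _.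
Qed.

Lemma det_norm_scalar (A : comNzRingType) (f : {rmorphism A -> A}) (d : nat)
    (M : 'M[A]_d) (a : A) :
  M *m map_mx f M = a%:M -> \det M * f (\det M) = a ^+ d.
Proof. by move=> eqMa; rewrite -det_map_mx -det_mulmx eqMa det_scalar. Qed.

Lemma norm_div_expr (K : fieldType) (f : {rmorphism K -> K}) (k : nat)
    (a b : K) :
  a != 0 -> f a = a -> b * f b = a ^+ (2 * k + 1) ->
  (a ^- k * b) * f (a ^- k * b) = a.
Proof.
move=> a0 fa nb; rewrite rmorphM fmorphV rmorphXn /= fa mulrACA nb.
rewrite -invfM -exprD addnn -mul2n addn1 exprSr mulKf //.
by rewrite expf_neq0.
Qed.

Theorem lemma5 (R : realType) (n d k : nat) (P : 'M[R[i]]_d) (mu : R[i])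
    (hn : (1 <= n)%N) (hd : d = (2 * k + 1)%N)
    (hP : in_GL (@cyclo_field R n) P)
    (hmu : mu \in @cyclo_real R n)
    (hPmu : P *m map_mx conjc P = mu%:M) :
  let x := mu ^- k * \det P in
  x \in @cyclo_field R n /\ x * conjc x = mu.
Proof.
subst d; move=> x; case: hP => FP uP _.
have /andP[Fmu Rmu] := hmu.
have norm_detP := det_norm_scalar _ _ _ _ _ hPmu.
have mu0 : mu != 0.
  (* If [mu = 0], then [det P] has norm [0 ^ d], which vanishes as [d] is
     odd, hence positive. *)
  have detP0 : \det P != 0 by rewrite -unitfE -unitmxE.
  apply: contraTneq detP0 => mu0; move/eqP: norm_detP.
  by rewrite mu0 expr0n addn_eq0 andbF mulf_eq0 fmorph_eq0 orbb negbK.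
split; first by rewrite rpredM ?det_mxOver // rpredV rpredX.
apply: norm_div_expr => //.
exact: conj_Creal.
Qed.
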